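(* For $n\ge 1$, let $\nu(n)$ denote the number of partitions of $n$ having no part equal to $1$, and let $\gamma(n)$ denote the number of partitions of $n$ having no part equal to $1$ and in which the largest part appears at least twice. Then, as $n\to\infty$, $$\nu(n)\ \sim\ \gamma(n)\sqrt{\frac{n}{\zeta(2)}},$$ where $\zeta(2)=\pi^2/6$.
   Context: Partitions with no part equal to $1$ are called non-unitary; those among them whose largest part occurs with multiplicity at least two are called ground state non-unitary partitions. $f(n)\sim g(n)$ means $f(n)/g(n)\to 1$. *)

(* Defs.v *)
From HB Require Import structures.
From mathcomp Require Import all_boot all_order all_algebra.
From mathcomp Require Import all_classical all_reals all_analysis.

Set Implicit Arguments.
Unset Strict Implicit.
Unset Printing Implicit Defensive.

(* A partition of n is encoded by its multiplicity function:
   m k = number of parts equal to k, for k = 0..n (parts are at most n,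
   and multiplicities are at most n).  Part 0 is not allowed (m 0 = 0). *)
Definition ptn_weight (n : nat) (m : {ffun 'I_n.+1 -> 'I_n.+1}) : nat :=
  \sum_(k < n.+1) k * m k.

Definition is_partition (n : nat) (m : {ffun 'I_n.+1 -> 'I_n.+1}) : bool :=
  (val (m ord0) == 0)%N && (ptn_weight m == n).

Definition non_unitary (n : nat) (m : {ffun 'I_n.+1 -> 'I_n.+1}) : bool :=
  [forall k : 'I_n.+1, (val k == 1) ==> (val (m k) == 0)%N].

Definition ground_state (n : nat) (m : {ffun 'I_n.+1 -> 'I_n.+1}) : bool :=
  [exists k : 'I_n.+1,
     (2 <= m k) && [forall j : 'I_n.+1, (k < j) ==> (val (m j) == 0)%N]].

Definition nu (n : nat) : nat :=
  #|[set m : {ffun 'I_n.+1 -> 'I_n.+1} | is_partition m && non_unitary m]|.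

Definition gamma (n : nat) : nat :=
  #|[set m : {ffun 'I_n.+1 -> 'I_n.+1} |
      [&& is_partition m, non_unitary m & ground_state m]]|.

(* Main.v *)
Require Import Defs.
From HB Require Import structures.
From mathcomp Require Import all_boot all_order all_algebra.
From mathcomp Require Import all_classical all_reals all_analysis.
From mathcomp Require Import ring lra zify.
Import Order.TTheory GRing.Theory Num.Theory.
Import numFieldNormedType.Exports.
Local Open Scope ring_scope.

Set Implicit Arguments.
Unset Strict Implicit.
Unset Printing Implicit Defensive.

(** Let F be the generating series of nu, so that P = F / (1 - X) generates the
    number p(n) of all partitions, and G = (1 - X) F generates gamma up to its
    first terms (lowering a largest part of multiplicity one by 1 gives
    gamma(n) = nu(n) - nu(n-1)).

    Logarithmic differentiation of G yields
      n gamma(n) = sum_(e >= 1) sum_(d >= 1) d gamma(n - d e) - 2 nu(n-1).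
    For fixed e the inner sum is p(n) / e^2 + O(nu(n)): the difference is F times
    a rational series whose poles lie at the e-th roots of unity, and these are
    harmless because F contains the factors 1 / (1 - X^(e+1)) and
    1 / (1 - X^(2e+1)).  For large e the inner sum is O(p(n) / e^2) uniformly,
    since gamma is dominated by a nondecreasing sequence.  Hence
      |n gamma(n) - zeta(2) p(n)| <= eps p(n) + C_eps nu(n).

    As nu and gamma are the first and second differences of p, the ratio
    w = nu / p solves w(n+1) (1 + w(n)) = w(n) + gamma(n+1) / p(n+1), a discrete
    form of w' = zeta(2) / n - w^2.  Comparison with explicit super- and
    subsolutions gives first w -> 0, so that n gamma(n) / p(n) -> zeta(2), and
    then sqrt n * w -> sqrt zeta(2); the theorem is the quotient of these limits. *)

(** * Formal power series *)

Definition fps (R : Type) : Type := nat -> R.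

Section FpsRing.
Variable R : comNzRingType.
Implicit Types f g h : fps R.

HB.instance Definition _ := GRing.Zmodule.copy (fps R) (nat -> R).

Definition fps_one : fps R := fun n => (n == 0)%:R.
Definition fps_mul f g : fps R := fun n => \sum_(i < n.+1) f i * g (n - i)%N.

Let trunc N f : {poly R} := \poly_(i < N) f i.

(** Every coefficient of a product is already that of a product of truncations, so associativity and
    commutativity are inherited from [{poly R}]. *)
Let fps_mul_coef N f g n : (n < N)%N ->
  fps_mul f g n = (trunc N f * trunc N g)`_n.
Proof.
move=> nN; rewrite coefM /fps_mul; apply: eq_bigr => i _.
by rewrite !coef_poly !(leq_trans _ nN) ?ltnS ?leq_subr// -ltnS.
Qed.

Let fps_mulA : associative fps_mul.
Proof.
move=> f g h; apply/funext => n.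
pose t := trunc n.+1.
transitivity ((t f * (t g * t h))`_n).
  rewrite coefM; apply: eq_bigr => i _.
  by rewrite coef_poly ltn_ord (fps_mul_coef (N := n.+1)) // ltnS leq_subr.
rewrite mulrA coefM; apply: eq_bigr => i _.
by rewrite coef_poly ltnS leq_subr (fps_mul_coef (N := n.+1)).
Qed.

Let fps_mulC : commutative fps_mul.
Proof.
move=> f g; apply/funext => n.
by rewrite !(fps_mul_coef (N := n.+1)) // mulrC.
Qed.

Let fps_mul1 : left_id fps_one fps_mul.
Proof.
move=> f; apply/funext => n; rewrite /fps_mul big_ord_recl /= /fps_one mul1r subn0.
by rewrite big1 ?addr0 // => i _; rewrite mul0r.
Qed.

Let fps_mulDl : left_distributive fps_mul +%R.
Proof.
move=> f g h; apply/funext => n; rewrite /fps_mul -[RHS]big_split /=.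
by apply: eq_bigr => i _; rewrite -mulrDl.
Qed.

Let fps_one_neq0 : fps_one != 0 :> fps R.
Proof.
by apply/eqP => /(congr1 (fun f => f 0%N))/eqP; rewrite /fps_one eqxx oner_eq0.
Qed.

HB.instance Definition _ := GRing.Zmodule_isComNzRing.Build (fps R)
  fps_mulA fps_mulC fps_mul1 fps_mulDl fps_one_neq0.

Lemma fpsD f g n : (f + g) n = f n + g n. Proof. by []. Qed.
Lemma fpsN f n : (- f) n = - f n. Proof. by []. Qed.
Lemma fpsB f g n : (f - g) n = f n - g n. Proof. by []. Qed.
Lemma fps0 n : (0 : fps R) n = 0. Proof. by []. Qed.
Lemma fps1 n : (1 : fps R) n = (n == 0%N)%:R. Proof. by []. Qed.
Lemma fpsM f g n : (f * g) n = \sum_(i < n.+1) f i * g (n - i)%N.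
Proof. by []. Qed.

Lemma fps_sum I (r : seq I) (Q : pred I) (F : I -> fps R) n :
  (\sum_(i <- r | Q i) F i) n = \sum_(i <- r | Q i) F i n.
Proof. by elim/big_rec2: _ => // i x y _ <-. Qed.

Lemma fpsMn f k n : (f *+ k) n = f n *+ k.
Proof. by elim: k => // k IH; rewrite !mulrS fpsD IH. Qed.

Lemma fpsMnat k f n : (k%:R * f) n = k%:R * f n.
Proof. by rewrite mulr_natl fpsMn mulr_natl. Qed.

Definition fpsX : fps R := fun n => (n == 1)%:R.

Lemma fpsXM f n : (fpsX * f) n = if n is n'.+1 then f n' else 0.
Proof.
rewrite fpsM big_ord_recl /= mul0r add0r; case: n => [|n]; first by rewrite big_ord0.
rewrite big_ord_recl /= /fpsX mul1r subn1 big1 ?addr0 // => i _.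
by rewrite mul0r.
Qed.

Lemma fpsXnM k f n : (fpsX ^+ k * f) n = if (k <= n)%N then f (n - k)%N else 0.
Proof.
elim: k n => [|k IH] n; first by rewrite expr0 mul1r subn0.
rewrite exprS -mulrA fpsXM; by case: n => [|n] //; rewrite IH.
Qed.

Lemma fpsXn k n : (fpsX ^+ k) n = (n == k)%:R.
Proof.
by rewrite -[_ ^+ k]mulr1 fpsXnM fps1 subn_eq0 [n == k]eqn_leq andbC; case: leqP.
Qed.

(** Congruence modulo [X^(N+1)]: infinite products are handled only through finite truncations. *)
Definition eq_upto N f g := forall n, (n <= N)%N -> f n = g n.

Lemma eq_upto_refl N f : eq_upto N f f. Proof. by []. Qed.

Lemma eq_upto_at N f g : eq_upto N f g -> f N = g N.
Proof. exact. Qed.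

Lemma eq_upto_trans N : Relation_Definitions.transitive (fps R) (eq_upto N).
Proof. by move=> f g h fg gh n nN; rewrite fg // gh. Qed.

Lemma eq_uptoM N f1 f2 g1 g2 :
  eq_upto N f1 f2 -> eq_upto N g1 g2 -> eq_upto N (f1 * g1) (f2 * g2).
Proof.
move=> f12 g12 n nN; rewrite !fpsM; apply: eq_bigr => i _.
by rewrite f12 ?g12 // ?(leq_trans (leq_subr _ _) nN) // (leq_trans _ nN) // -ltnS.
Qed.

Lemma eq_upto_prod N I (r : seq I) (Q : pred I) (F1 F2 : I -> fps R) :
  (forall i, Q i -> eq_upto N (F1 i) (F2 i)) ->
  eq_upto N (\prod_(i <- r | Q i) F1 i) (\prod_(i <- r | Q i) F2 i).
Proof.
move=> F12; elim/big_rec2: _ => [|i x y Qi xy]; first exact: eq_upto_refl.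
by apply: eq_uptoM => //; exact: F12.
Qed.

Lemma eq_upto1M N f g : eq_upto N g 1 -> eq_upto N (f * g) f.
Proof. by move=> g1; rewrite -[X in eq_upto _ _ X]mulr1; apply: eq_uptoM. Qed.

(* The Euler operator [X d/dX]. *)
Definition fps_theta f : fps R := fun n => n%:R * f n.

Lemma fps_thetaM f g : fps_theta (f * g) = fps_theta f * g + f * fps_theta g.
Proof.
apply/funext => n; rewrite fpsD !fpsM /fps_theta fpsM mulr_sumr -big_split /=.
apply: eq_bigr => i _.
rewrite -{1}(subnK (_ : i <= n)%N) -1?ltnS // natrD; ring.
Qed.

Lemma fps_theta1 : fps_theta 1 = 0.
Proof.
by apply/funext => -[|n]; rewrite /fps_theta fps1 ?mul0r ?mulr0.
Qed.

Lemma fps_thetaXn k : fps_theta (fpsX ^+ k) = k%:R * fpsX ^+ k.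
Proof.
apply/funext => n; rewrite /fps_theta fpsMnat fpsXn.
by case: eqP => [->|]//; rewrite !mulr0.
Qed.

Lemma fps_thetaB f g : fps_theta (f - g) = fps_theta f - fps_theta g.
Proof. by apply/funext => n; rewrite /fps_theta !fpsB mulrBr. Qed.

(** The inverse of [1 - X^a] for [0 < a], given by its coefficients. *)
Definition geo (a : nat) : fps R := fun n => (a %| n)%:R.

Lemma geoK a : (0 < a)%N -> (1 - fpsX ^+ a) * geo a = 1.
Proof.
move=> a0; rewrite mulrBl mul1r; apply/funext => n.
rewrite fpsB fpsXnM fps1 /geo; case: leqP => an.
  by rewrite -{1}(subnK an) dvdn_addl ?dvdnn // subrr; case: n an => //; rewrite leqNgt a0.
by rewrite subr0; case: n an => [|n] an; [rewrite dvdn0|rewrite gtnNdvd].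
Qed.

Lemma geoXn a : (0 < a)%N -> geo a = 1 + fpsX ^+ a * geo a.
Proof. by move=> a0; rewrite -(geoK a0); ring. Qed.

Lemma fps_theta_geo a : (0 < a)%N ->
  fps_theta (geo a) = geo a * (a%:R * (fpsX ^+ a * geo a)).
Proof.
move=> a0; have := congr1 fps_theta (geoK a0).
rewrite fps_thetaM fps_theta1 fps_thetaB fps_theta1 fps_thetaXn sub0r => E.
have {}E : (1 - fpsX ^+ a) * fps_theta (geo a) = a%:R * fpsX ^+ a * geo a.
  by apply: subr0_eq; rewrite -E; ring.
transitivity ((1 - fpsX ^+ a) * geo a * fps_theta (geo a)).
  by rewrite geoK // mul1r.
by rewrite mulrAC E; ring.
Qed.

(** The q-integer [[k] = (1 - X^k) / (1 - X)], with [X] in the role of q. *)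
Definition qint (k : nat) : fps R := \sum_(i < k) fpsX ^+ i.

Lemma qintM k : (1 - fpsX) * qint k = 1 - fpsX ^+ k.
Proof. by rewrite -[RHS]opprB subrX1 -mulNr opprB. Qed.

Lemma qintS k : qint k.+1 = 1 + fpsX * qint k.
Proof.
rewrite /qint big_ord_recl expr0 mulr_sumr; congr (_ + _).
by apply: eq_bigr => i _; rewrite exprS.
Qed.

Lemma qint_double k : qint (k + k) = (1 + fpsX ^+ k) * qint k.
Proof.
rewrite /qint big_split_ord /= mulrDl mul1r mulr_sumr; congr (_ + _).
by apply: eq_bigr => i _; rewrite exprD.
Qed.

Lemma qint_geo k : (0 < k)%N -> (1 - fpsX) * qint k * geo k = 1.
Proof. by move=> k0; rewrite qintM geoK. Qed.

Lemma geo1K : (1 - fpsX) * geo 1 = 1.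
Proof. by have := geoK (ltn0Sn 0); rewrite expr1. Qed.

(* The q-analogue of coprimality, [s]_q = 1 + X T [e]_q, read as a partial
   fraction decomposition. *)
Lemma geo_partial_fraction e s (T : fps R) : (0 < e)%N -> (0 < s)%N ->
  qint s = 1 + fpsX * T * qint e ->
  geo e - fpsX * T * geo s = (1 - fpsX) * geo e * geo s.
Proof.
move=> e0 s0 sE; have Ke := qint_geo e0; have Ks := qint_geo s0.
transitivity (geo e * ((1 - fpsX) * qint s * geo s) -
  fpsX * T * geo s * ((1 - fpsX) * qint e * geo e)); first by rewrite Ke Ks !mulr1.
by rewrite sE; ring.
Qed.

End FpsRing.
Arguments fpsX {R}.
Arguments geo {R}.
Arguments qint {R}.

(** * Generating functions of the partition counts *)

Section Counting.
Variable R : comNzRingType.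
Local Notation X := (@fpsX R).

Definition parts2 (k : nat) : fps R := \prod_(2 <= i < k.+1) geo i.

Lemma parts2S k : (0 < k)%N -> parts2 k.+1 = parts2 k * geo k.+1.
Proof. by move=> k0; rewrite /parts2 big_nat_recr. Qed.

Lemma parts2_1 : parts2 1 = 1. Proof. by rewrite /parts2 big_geq. Qed.

Lemma parts2_diff k : (0 < k)%N ->
  parts2 k.+1 - parts2 k = X ^+ k.+1 * parts2 k.+1.
Proof. by move=> k0; rewrite parts2S // {1}geoXn //; ring. Qed.

Lemma parts2_stable m n : (0 < m)%N -> (m <= n)%N ->
  eq_upto m (parts2 m) (parts2 n).
Proof.
move=> m0 /subnK <-; elim: (n - m)%N => [|k IH]; first exact: eq_upto_refl.
apply: eq_upto_trans IH _ => i im.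
rewrite addSn parts2S ?addn_gt0 ?m0 ?orbT //; symmetry.
apply: (eq_upto1M (N := m)) => // l lm; rewrite fps1 /geo; case: l lm => [|l] lm.
  by rewrite dvdn0.
by rewrite gtnNdvd // ltnS (leq_trans lm) // leq_addl.
Qed.

Lemma geo_trunc n i : (0 < i)%N -> eq_upto n (\sum_(j < n.+1) X ^+ (i * j)) (geo i).
Proof.
move=> i0 m mn; rewrite fps_sum /geo.
under eq_bigr do rewrite fpsXn.
case: (boolP (i %| m)%N) => [/dvdnP[j mE]|im]; last first.
  by rewrite big1 // => j _; case: eqP im => // ->; rewrite dvdn_mulr.
have jn : (j < n.+1)%N by rewrite ltnS (leq_trans _ mn) // mE leq_pmulr.
rewrite (bigD1 (Ordinal jn)) //= mE mulnC eqxx big1 ?addr0 // => l lj.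
rewrite eqn_pmul2l //; case: eqP => // jl; case/eqP: lj; exact: val_inj.
Qed.

(** Expanding the product chooses a multiplicity [m i] in each factor, so each multiplicity function
    contributes one monomial, of degree its weight. *)
Lemma coef_prod_sum n (Q : 'I_n.+1 -> pred 'I_n.+1) :
  (\prod_(i < n.+1) \sum_(j < n.+1 | Q i j) X ^+ (i * j)) n =
  #|[set m : {ffun 'I_n.+1 -> 'I_n.+1} |
      [forall i, Q i (m i)] && (ptn_weight m == n)]|%:R.
Proof.
rewrite bigA_distr_big_dep fps_sum -sum1_card natr_sum.
rewrite big_mkcond [RHS]big_mkcond; apply: eq_bigr => m _ /=.
have -> : (m \in family Q) = [forall i, Q i (m i)] by [].
rewrite inE; case: ifP => _ //=.
by rewrite prodrXr fpsXn eq_sym /ptn_weight; case: eqP.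
Qed.

Lemma partition_small n (m : {ffun 'I_n.+1 -> 'I_n.+1}) :
  is_partition m -> non_unitary m ->
  [forall i : 'I_n.+1, (i <= 1)%N ==> (m i == ord0)].
Proof.
case/andP => m0 _ /forallP m1; apply/forallP => i; apply/implyP.
rewrite leq_eqVlt ltnS leqn0 => /orP[i1|/eqP i0]; first exact: (implyP (m1 i)).
by have -> : i = ord0 by exact: val_inj.
Qed.

Lemma nu_coef n : (nu n)%:R = parts2 n n :> R.
Proof.
pose Q (i : 'I_n.+1) : pred 'I_n.+1 := fun j => (i <= 1)%N ==> (j == ord0).
rewrite /nu; have -> : [set m : {ffun 'I_n.+1 -> 'I_n.+1} | is_partition m && non_unitary m] =
    [set m : {ffun 'I_n.+1 -> 'I_n.+1} | [forall i, Q i (m i)] && (ptn_weight m == n)].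
  apply/setP => m; rewrite !inE; have [w|w] := eqVneq (ptn_weight m) n; last first.
    by rewrite /is_partition (negbTE w) !andbF.
  rewrite andbT.
  apply/andP/forallP => [[m0 mN]|mQ].
    exact/forallP/partition_small.
  split; first by rewrite /is_partition w eqxx andbT; exact: (implyP (mQ ord0)).
  by apply/forallP => i; apply/implyP => /eqP i1; apply: (implyP (mQ i)); rewrite i1.
rewrite -coef_prod_sum /parts2 big_geq_mkord [X in _ = X n]big_mkcond /=.
apply: eq_upto_at; apply: eq_upto_prod => i _; rewrite /Q.
case: leqP => i1 /=; last by apply: geo_trunc; exact: ltnW.
rewrite (big_pred1 ord0) ?muln0 ?expr0 //.
Qed.

(** Partitions are sorted by their largest part [k]: [X^(2k)] carries two compulsory copies of it
    and [parts2 k] all remaining parts. *)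
Lemma gamma_coef n :
  (gamma n)%:R = (\sum_(2 <= k < n.+1) X ^+ (k + k) * parts2 k) n :> R.
Proof.
pose Q (k i : 'I_n.+1) : pred 'I_n.+1 := fun j =>
  [&& (i <= 1)%N ==> (j == ord0), (i == k) ==> (2 <= j)%N & (k < i)%N ==> (j == ord0)].
(* At most one [k] contributes to the sum, because the largest part is unique. *)
have QE (m : {ffun 'I_n.+1 -> 'I_n.+1}) :
  [&& is_partition m, non_unitary m & ground_state m]%:R =
  \sum_(k < n.+1) ([forall i, Q k i (m i)] && (ptn_weight m == n))%:R :> R.
  have [|H] := boolP [&& _, _ & _].
    case/and3P => mP mN /existsP[k /andP[k2 /forallP kl]].
    rewrite (bigD1 k) //= big1 => [|l lk].
      case/andP: (mP) => m0 ->; rewrite andbT addr0.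
      suff -> : [forall i, Q k i (m i)] by [].
      apply/forallP => i; apply/and3P; split.
      - exact: (forallP (partition_small mP mN)).
      - by apply/implyP => /eqP ->.
      - exact: kl.
    case: forallP => //= lQ; exfalso.
    case: (ltngtP k l) => kl'.
    - have /and3P[_ + _] := lQ l; rewrite eqxx /=.
      by have /implyP/(_ kl')/eqP -> := kl l.
    - have /and3P[_ _ /implyP/(_ kl')/eqP mk] := lQ k.
      by move: k2; rewrite mk.
    - by case/eqP: lk; exact: val_inj.
  rewrite big1 // => k _; case: forallP => //= kQ.
  have [w|//] := boolP (_ == _); case/negP: H; apply/and3P.
  have small (i : 'I_n.+1) : (i <= 1)%N -> m i = ord0.
    by move=> i1; have /and3P[/implyP/(_ i1)/eqP] := kQ i.
  split.
  - by rewrite /is_partition w small.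
  - by apply/forallP => i; apply/implyP => /eqP i1; rewrite small // i1.
  - apply/existsP; exists k; have /and3P[_ + _] := kQ k; rewrite eqxx /= => -> /=.
    by apply/forallP => j; have /and3P[_ _] := kQ j.
rewrite /gamma -sum1_card natr_sum big_mkcond /=.
under eq_bigr => m _.
  have -> : (if m \in [set m : {ffun 'I_n.+1 -> 'I_n.+1} | [&& is_partition m, non_unitary m & ground_state m]]
    then 1 else 0) = [&& is_partition m, non_unitary m & ground_state m]%:R :> R.
    by rewrite inE; case: ifP.
  rewrite QE; over.
rewrite exchange_big /= fps_sum big_geq_mkord [RHS]big_mkcond /=.
apply: eq_bigr => k _.
transitivity (#|[set m : {ffun 'I_n.+1 -> 'I_n.+1} |
      [forall i, Q k i (m i)] && (ptn_weight m == n)]|%:R : R).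
  rewrite -sum1_card natr_sum [RHS]big_mkcond /=; apply: eq_bigr => m _.
  by rewrite inE; case: ifP.
rewrite -coef_prod_sum; case: leqP => k1.
  rewrite (bigD1 k) //= [X in X * _]big_pred0 ?mul0r // => j.
  rewrite /Q k1 eqxx /=; apply/and3P => -[/eqP ->] //.
have -> : X ^+ (k + k) * parts2 k =
  \prod_(i < n.+1) (if (i <= 1)%N || (k < i)%N then 1 else if i == k then X ^+ (k + k) * geo k else geo i).
  rewrite (bigD1 k) //= leqNgt k1 ltnn eqxx /= -mulrA; congr (_ * _).
  rewrite /parts2 big_nat_recr //= mulrC; congr (_ * _).
  rewrite big_geq_mkord (big_ord_widen_cond n.+1 (fun i => 1 < i)%N geo) 1?ltnW //.
  rewrite big_mkcond [RHS]big_mkcond; apply: eq_bigr => i _ /=.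
  by rewrite -val_eqE /=; case: (leqP i 1) => i1 //=; case: (ltngtP i k).
apply: eq_upto_at; apply: eq_upto_prod => i _.
case: (leqP i 1) => i1 /=.
  rewrite (big_pred1 ord0) => [|j]; first by rewrite muln0.
  have ik : (i < k)%N by exact: leq_ltn_trans i1 k1.
  have /negbTE ik' : i != k by rewrite -val_eqE /= ltn_eqF.
  by rewrite /Q i1 ik' [(k < i)%N]ltnNge (ltnW ik) /= andbT.
rewrite /Q; case: (ltngtP k i) => ki /=.
- rewrite (big_pred1 ord0) => [|j]; first by rewrite muln0.
  have /negbTE ik' : i != k by rewrite -val_eqE /= gtn_eqF.
  by rewrite [(i <= 1)%N]leqNgt i1 ik'.
- have /negbTE ik' : i != k by rewrite -val_eqE /= ltn_eqF.
  rewrite ik'; under eq_bigl => j do rewrite [(i <= 1)%N]leqNgt i1 /=.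
  by apply: geo_trunc; exact: ltnW.
- have ik : i = k by exact: val_inj.
  rewrite ik eqxx.
  rewrite (eq_bigl (fun j : 'I_n.+1 => (1 < j)%N)) => [|j]; last first.
    by rewrite [(k <= 1)%N]leqNgt k1 /= andbT.
  have n1 : (1 < n.+1)%N by exact: ltn_trans k1 (ltn_ord k).
  (* Compared with [geo k = 1 + X^k + X^(2k) geo k], the terms of multiplicity 0 and 1 cancel. *)
  have E : \sum_(j < n.+1) X ^+ (k * j) = 1 + X ^+ k + \sum_(j < n.+1 | (1 < j)%N) X ^+ (k * j).
    rewrite (bigD1 ord0) // (bigD1 (Ordinal n1)) //= muln0 expr0 muln1 addrA.
    by congr (_ + _); apply: eq_bigl => j; rewrite -!val_eqE /=; case: (val j) => [|[]].
  have k0 : (0 < k)%N by exact: ltnW.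
  move=> a an; have := geo_trunc k0 an.
  rewrite E geoXn // {1}geoXn // mulrDr mulr1 addrA mulrA -exprD !fpsD => /addrI ->.
  by rewrite -geoXn.
Qed.

Definition nu_fps : fps R := fun n => (nu n)%:R.

Lemma nu_fps0 : nu_fps 0%N = 1.
Proof. by rewrite /nu_fps nu_coef /parts2 big_geq. Qed.

Lemma nu_fps1 : nu_fps 1%N = 0.
Proof. by rewrite /nu_fps nu_coef parts2_1. Qed.

Lemma nu_fps2 : nu_fps 2 = 1.
Proof. by rewrite /nu_fps nu_coef parts2S // parts2_1 mul1r. Qed.

Lemma nu_fps_trunc N : (0 < N)%N -> eq_upto N nu_fps (parts2 N).
Proof.
move=> N0 [|n] nN; last by rewrite /nu_fps nu_coef (parts2_stable _ nN).
by rewrite nu_fps0 -(parts2_stable (ltn0Sn 0) N0) // parts2_1.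
Qed.

(** By [parts2_diff] used twice, the summand of index [k >= 3] is [parts2 k - parts2 (k-1)] minus
    [X] times [parts2 (k-1) - parts2 (k-2)]. The summand [k = 2] departs from this pattern, whence
    the extra [X]. *)
Lemma gamma_telescope n : (1 < n)%N ->
  \sum_(2 <= k < n.+1) X ^+ (k + k) * parts2 k =
  parts2 n - 1 - X * (parts2 n.-1 - 1 + X).
Proof.
case: n => // n; rewrite ltnS => n0 /=; elim: n n0 => // -[_ _|n IH _].
  rewrite big_nat1 parts2S // parts2_1 mul1r {2}geoXn // {2}geoXn //; ring.
rewrite big_nat_recr //= IH //.
have E2 := parts2_diff (ltn0Sn n.+1); have E1 := parts2_diff (ltn0Sn n).
have -> : X ^+ (n.+3 + n.+3) * parts2 n.+3 =
    parts2 n.+3 - parts2 n.+2 - X * (parts2 n.+2 - parts2 n.+1).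
  rewrite E1 E2 mulrA -exprS -mulrBr E2.
  by rewrite mulrA -exprD.
ring.
Qed.

(** The corrections [- 1 + X - X^2] left by the telescoping reach degree 2. At [n = 2] the identity
    fails: [gamma 2 = 0] but [nu 2 - nu 1 = 1]. *)
Lemma gamma_nu n : (2 < n)%N -> (gamma n)%:R = nu_fps n - nu_fps n.-1 :> R.
Proof.
case: n => [|[|[|n]]] // _.
rewrite gamma_coef gamma_telescope //= !fpsB fpsXM fpsD fpsB !fps1 /= /fpsX /=.
by rewrite /nu_fps !nu_coef subr0 addr0 subr0.
Qed.

End Counting.

(** * Coefficientwise domination *)

Section Domination.
Variable R : realFieldType.
Implicit Types f g h : fps R.
Local Notation X := (@fpsX R).

Definition dominated f g := forall n, `|f n| <= g n.
Definition nonneg f := forall n, 0 <= f n.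

Lemma dominatedM f1 g1 f2 g2 :
  dominated f1 g1 -> dominated f2 g2 -> dominated (f1 * f2) (g1 * g2).
Proof.
move=> fg1 fg2 n; rewrite !fpsM; apply: le_trans (ler_norm_sum _ _ _) _.
by apply: ler_sum => i _; rewrite normrM ler_pM.
Qed.

Lemma dominatedD f1 g1 f2 g2 :
  dominated f1 g1 -> dominated f2 g2 -> dominated (f1 + f2) (g1 + g2).
Proof.
by move=> fg1 fg2 n; rewrite !fpsD (le_trans (ler_normD _ _)) // lerD.
Qed.

Lemma dominatedB f1 g1 f2 g2 :
  dominated f1 g1 -> dominated f2 g2 -> dominated (f1 - f2) (g1 + g2).
Proof.
by move=> fg1 fg2; apply: dominatedD => // n; rewrite fpsN normrN.
Qed.

Lemma nonneg_dominated f : nonneg f -> dominated f f.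
Proof. by move=> f0 n; rewrite ger0_norm. Qed.

Lemma nonnegM f g : nonneg f -> nonneg g -> nonneg (f * g).
Proof. by move=> f0 g0 n; rewrite fpsM sumr_ge0 // => i _; rewrite mulr_ge0. Qed.

Lemma nonneg_geo a : nonneg (geo a). Proof. by move=> n; exact: ler0n. Qed.

Lemma nonneg_prod_geo (r : seq nat) (Q : pred nat) : nonneg (\prod_(i <- r | Q i) geo i).
Proof.
elim/big_rec: _ => [n|i f _ f0]; first by rewrite fps1 ler0n.
by apply: nonnegM => //; exact: nonneg_geo.
Qed.

Lemma dominated_Xn_geo k a : dominated (X ^+ k * geo a) (geo 1).
Proof.
move=> n; rewrite fpsXnM /geo dvd1n; case: ifP => _; last by rewrite normr0.
by rewrite normr_nat lern1 leq_b1.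
Qed.

Lemma dominated_geo a : dominated (geo a) (geo 1).
Proof. by rewrite -[geo a]mul1r -(expr0 X); exact: dominated_Xn_geo. Qed.

(** Multiplication by [f] costs only a constant factor against any nondecreasing majorant.
    Polynomials have this property, which absorbs the numerators of the rational series below. *)
Definition bounded_op f := exists2 C : R, 0 <= C & forall g (h : nat -> R),
  {homo h : m n / (m <= n)%N >-> m <= n} -> (forall n, `|g n| <= h n) ->
  forall n, `|(f * g) n| <= C * h n.

Lemma bounded_opXn k : bounded_op (X ^+ k).
Proof.
exists 1 => // g h hh gh n; rewrite mul1r fpsXnM; case: leqP => kn.
  by rewrite (le_trans (gh _)) // hh // leq_subr.
by rewrite normr0; apply: le_trans (gh _); exact: normr_ge0.
Qed.

Lemma bounded_opD f1 f2 : bounded_op f1 -> bounded_op f2 -> bounded_op (f1 + f2).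
Proof.
move=> [C1 C10 b1] [C2 C20 b2]; exists (C1 + C2) => [|g h hh gh n]; first exact: addr_ge0.
by rewrite mulrDl fpsD (le_trans (ler_normD _ _)) // mulrDl lerD ?b1 ?b2.
Qed.

Lemma bounded_opN f : bounded_op f -> bounded_op (- f).
Proof.
by move=> [C C0 b]; exists C => // g h hh gh n; rewrite mulNr fpsN normrN b.
Qed.

Lemma bounded_opM f1 f2 : bounded_op f1 -> bounded_op f2 -> bounded_op (f1 * f2).
Proof.
move=> [C1 C10 b1] [C2 C20 b2]; exists (C1 * C2) => [|g h hh gh n]; first exact: mulr_ge0.
rewrite -!mulrA; apply: (b1 _ (fun n => C2 * h n)) => [i j ij|i]; last exact: b2.
by rewrite ler_wpM2l // hh.
Qed.

Lemma bounded_op_sum I (r : seq I) (F : I -> fps R) :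
  (forall i, bounded_op (F i)) -> bounded_op (\sum_(i <- r) F i).
Proof.
move=> Fb; elim/big_rec: _ => [|i f _ fb]; last exact: bounded_opD.
exists 0 => // g h hh gh n; rewrite !mul0r fps0 normr0.
by [].
Qed.

Lemma bounded_op_qint k : bounded_op (qint k).
Proof. by apply: bounded_op_sum => i; exact: bounded_opXn. Qed.

Lemma geo1M f n : (geo 1 * f) n = \sum_(k < n.+1) f k.
Proof.
rewrite mulrC fpsM; apply: eq_bigr => i _; by rewrite /geo dvd1n mulr1.
Qed.

Lemma geo1_sqr n : (geo 1 * geo 1 : fps R) n = n.+1%:R.
Proof.
by rewrite geo1M (eq_bigr (fun=> 1)) => [|i _]; rewrite ?sumr_const ?card_ord // /geo dvd1n.
Qed.

(** The coefficient of [1 / (1 - X)^3] is [(n + 1) (n + 2) / 2]. *)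
Lemma geo1_cube n : n%:R ^+ 2 <= 2 * (geo 1 * (geo 1 * geo 1) : fps R) n.
Proof.
rewrite geo1M; suff -> : 2 * \sum_(k < n.+1) (geo 1 * geo 1 : fps R) k = (n.+1 * n.+2)%:R.
  by rewrite -natrX ler_nat; lia.
elim: n => [|n IH]; first by rewrite big_ord1 geo1_sqr mulr1.
by rewrite big_ord_recr mulrDr IH geo1_sqr !natrM -!natr1; ring.
Qed.

(* [sigma_term e] is the series of the [d X^(d e)]. *)
Definition sigma_term (e : nat) : fps R := X ^+ e * geo e * geo e.

Lemma sigma_termE e n : (0 < e)%N -> e%:R * sigma_term e n = n%:R * geo e n.
Proof.
move=> e0; rewrite -[RHS]/(fps_theta (geo e) n) fps_theta_geo //.
by rewrite mulrCA fpsMnat /sigma_term [geo e * _]mulrC.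
Qed.

Lemma nonneg_sigma_term e : (0 < e)%N -> nonneg (sigma_term e).
Proof.
move=> e0 n; have e0' : 0 < e%:R :> R by rewrite ltr0n.
by rewrite -(pmulr_rge0 _ e0') sigma_termE // mulr_ge0 ?ler0n.
Qed.

(** Multiplied by [e], the partial sum has at most [n %/ e] nonzero terms, each at most [n]; so
    [e^2] times it is at most [n^2]. The uniformity in [e] serves the tail of the sum over [e]. *)
Lemma sum_sigma_term e n : (0 < e)%N ->
  (geo 1 * sigma_term e) n <= 2 / e%:R ^+ 2 * (geo 1 * (geo 1 * geo 1)) n.
Proof.
move=> e0; have e0' : 0 < e%:R :> R by rewrite ltr0n.
rewrite mulrAC ler_pdivlMr ?exprn_gt0 //; apply: le_trans (geo1_cube n).
rewrite geo1M mulrC expr2 -mulrA mulr_sumr.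
under eq_bigr do rewrite sigma_termE //.
apply: (@le_trans _ _ (e%:R * (\sum_(i < n.+1) n%:R * (if (0 < i)%N then geo e i else 0)))).
  rewrite ler_pM2l //; apply: ler_sum => -[[|i] ni] _ /=; first by rewrite mul0r mulr0.
  by rewrite ler_wpM2r ?nonneg_geo // ler_nat -ltnS.
rewrite -mulr_sumr -big_mkcond /= mulrCA expr2 ler_wpM2l // /geo -natr_sum -natrM ler_nat.
have <- : (n %/ e = \sum_(i < n.+1 | (0 < i)%N) (e %| i))%N.
  by rewrite divn_count_dvd big_geq_mkord.
by rewrite mulnC leq_trunc_div.
Qed.

End Domination.

(** * The second-order relation between [gamma] and the partition function *)

Section SecondOrder.
Variable R : realFieldType.
Local Notation X := (@fpsX R).
Local Notation F := (nu_fps R).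
Local Notation G := ((1 - X) * F).
Local Notation P := (geo 1 * F).

(* [nu] itself is nondecreasing only from 1 on, as [nu 0 = 1] and [nu 1 = 0]. *)
Definition nu_max2 (n : nat) : R := F (maxn n 2).

Lemma nu_fps_homo m n : (0 < m)%N -> (m <= n)%N -> F m <= F n.
Proof.
move=> m0 /subnK <-; elim: (n - m)%N => [|k IH] //; apply: le_trans IH _.
have [|k2] := leqP (k + m)%N 1; last first.
  by have := ler0n R (gamma (k.+1 + m)); rewrite gamma_nu ?subr_ge0.
move=> km; have -> : (k + m = 1)%N by lia.
by rewrite nu_fps1 ler0n.
Qed.

Lemma nu_max2_homo : {homo nu_max2 : m n / (m <= n)%N >-> m <= n}.
Proof. by move=> m n mn; apply: nu_fps_homo; lia. Qed.

Lemma nu_le_max2 n : `|F n| <= nu_max2 n.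
Proof.
rewrite ger0_norm ?ler0n //; case: n => [|n]; last by apply: nu_fps_homo; lia.
by rewrite /nu_max2 nu_fps0 nu_fps2.
Qed.

Lemma ptn_homo : {homo (P : nat -> R) : m n / (m <= n)%N >-> m <= n}.
Proof.
move=> m n /subnK <-; elim: (n - m)%N => [|k IH] //; apply: le_trans IH _.
by rewrite !geo1M addSn [leRHS]big_ord_recr lerDl ler0n.
Qed.

Lemma ptn_norm n : `|P n| <= P n.
Proof. by rewrite ger0_norm // geo1M sumr_ge0 // => i _; exact: ler0n. Qed.

(** The two factors delete the parts [s] and [t] from the product for [F], and what remains still
    counts partitions. *)
Lemma nonneg_nu_without2 s t : (1 < s)%N -> (1 < t)%N -> s != t ->
  nonneg ((1 - X ^+ s) * (1 - X ^+ t) * F).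
Proof.
move=> s1 t1 st n; pose N := (n + s + t)%N.
have N0 : (0 < N)%N by rewrite /N; lia.
have -> : ((1 - X ^+ s) * (1 - X ^+ t) * F) n = ((1 - X ^+ s) * (1 - X ^+ t) * parts2 R N) n.
  apply: (@eq_uptoM _ N) => //; last by rewrite /N; lia.
  exact: nu_fps_trunc.
rewrite /parts2 (bigD1_seq s) /= ?iota_uniq ?mem_index_iota //; last by rewrite /N; lia.
rewrite -big_filter (bigD1_seq t) /= ?filter_uniq ?iota_uniq //; last first.
  by rewrite mem_filter mem_index_iota eq_sym st /N; lia.
set Z := \prod_(_ <- _ | _) _.
have -> : (1 - X ^+ s) * (1 - X ^+ t) * (geo s * (geo t * Z)) =
  ((1 - X ^+ s) * geo s) * ((1 - X ^+ t) * geo t) * Z by ring.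
by rewrite !geoK ?mul1r; [exact: nonneg_prod_geo | lia | lia].
Qed.

(** Times [e^2], the difference is [F (1 - X) (e^2 X^e - [e]^2) / (1 - X^e)^2]. The numerator [e^2
    X^e - [e]^2] yields a further factor [1 - X]. Borrowing [geo s] and [geo t] from [F] then turns
    each [(1 - X) geo e] into a series with bounded coefficients, [U] or [V]. *)
Lemma sigma_main_term e : (0 < e)%N -> exists2 C : R, 0 <= C &
  forall n, `|(G * sigma_term R e) n - P n / e%:R ^+ 2| <= C * nu_max2 n.
Proof.
(* Both are 1 modulo [e], which makes the q-Bezout relations explicit: [[s] = 1 + X [e]] and [[t] =
   1 + X (1 + X^e) [e]]. *)
move=> e0; pose s := e.+1; pose t := (e + e).+1.
pose U := geo e - X * 1 * geo s : fps R.
pose V := geo e - X * (1 + X ^+ e) * geo t : fps R.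
pose F2 := (1 - X ^+ s) * (1 - X ^+ t) * F.
(* The quotient of [e^2 X^e - [e]^2] by [1 - X], found by expanding [[e]^2] as the sum of the
   [X^(a+b)]. *)
pose W := \sum_(a < e) \sum_(b < e) (qint (a + b) - qint e) : fps R.
have s0 : (0 < s)%N by []. have t0 : (0 < t)%N by [].
have UE : U = (1 - X) * geo e * geo s.
  by apply: geo_partial_fraction => //; rewrite qintS mulr1.
have VE : V = (1 - X) * geo e * geo t.
  by apply: geo_partial_fraction => //; rewrite qintS qint_double mulrA.
have WE : (1 - X) * W = (e%:R ^+ 2 * X ^+ e - qint e * qint e).
  rewrite /W mulr_sumr (eq_bigr (fun a : 'I_e => \sum_(b < e) (X ^+ e - X ^+ a * X ^+ b))); last first.
    move=> a _; rewrite mulr_sumr; apply: eq_bigr => b _.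
    by rewrite mulrBr !qintM exprD; ring.
  rewrite (eq_bigr (fun a : 'I_e => e%:R * X ^+ e - X ^+ a * qint e)); last first.
    by move=> a _; rewrite sumrB sumr_const card_ord -mulr_sumr mulr_natl.
  by rewrite sumrB sumr_const card_ord -mulr_suml -[(_ * _) *+ e]mulr_natl -/(qint e); ring.
have key : e%:R ^+ 2 * (G * sigma_term R e) - P = W * (F2 * (U * V)).
  have Ke := qint_geo R e0.
  have -> : W * (F2 * (U * V)) = F * ((1 - X) * W) * (1 - X) * geo e * geo e *
     ((1 - X ^+ s) * geo s) * ((1 - X ^+ t) * geo t).
    by rewrite /F2 UE VE; ring.
  have PE : P = F * (qint e * qint e) * (1 - X) * geo e * geo e.
    transitivity (F * (qint e * geo e * ((1 - X) * qint e * geo e))); last by ring.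
    rewrite Ke mulr1 [P]mulrC; congr (_ * _).
    transitivity (geo 1 * ((1 - X) * qint e * geo e)); first by rewrite Ke mulr1.
    transitivity ((1 - X) * geo 1 * (qint e * geo e)); first by ring.
    by rewrite geo1K mul1r.
  by rewrite WE !geoK // !mulr1 PE /sigma_term; ring.
have [C C0 bC] := bounded_opM (bounded_op_qint R s) (bounded_op_qint R t).
have [K K0 bK] : bounded_op W.
  apply: bounded_op_sum => a; apply: bounded_op_sum => b.
  by apply: bounded_opD; [|apply: bounded_opN]; exact: bounded_op_qint.
(* [U] has two terms and [V] three, each dominated by [geo 1]; this is the origin of the constant
   6. *)
have dUV : dominated (U * V) ((geo 1 + geo 1) * (geo 1 + (geo 1 + geo 1))).
  apply: dominatedM; apply: dominatedB; try exact: dominated_geo.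
    by rewrite mulr1; exact: (dominated_Xn_geo R 1).
  rewrite mulrDr mulr1 mulrDl; apply: dominatedD; first exact: (dominated_Xn_geo R 1).
  by rewrite -exprS; exact: dominated_Xn_geo.
have bUV n : `|(F2 * (U * V)) n| <= 6 * C * nu_max2 n.
  apply: le_trans (dominatedM (nonneg_dominated _) dUV n) _.
    by apply: nonneg_nu_without2; rewrite /s /t; lia.
  (* The two factors [geo 1] cancel against [F2 = (1 - X)^2 [s] [t] F], leaving a polynomial times
     [F]. *)
  have -> : F2 * ((geo 1 + geo 1) * (geo 1 + (geo 1 + geo 1))) = 6%:R * (qint s * qint t * F).
    have -> : F2 = (1 - X) * (1 - X) * (qint s * qint t * F).
      by rewrite /F2 -!qintM; ring.
    transitivity (6%:R * (((1 - X) * geo 1) * ((1 - X) * geo 1) * (qint s * qint t * F))).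
      ring.
    by rewrite geo1K !mul1r.
  rewrite fpsMnat -[leRHS]mulrA ler_wpM2l // (le_trans (ler_norm _)) //.
  by apply: bC => [|m]; [exact: nu_max2_homo | exact: nu_le_max2].
exists (K * (6 * C) / e%:R ^+ 2) => [|n]; first by rewrite !mulr_ge0 ?invr_ge0 ?exprn_ge0.
have e2 : 0 < e%:R ^+ 2 :> R by rewrite exprn_gt0 // ltr0n.
rewrite [leRHS]mulrAC ler_pdivlMr // -[X in _ * X <= _](gtr0_norm e2) -normrM mulrBl divfK ?gt_eqF //.
have -> : (G * sigma_term R e) n * e%:R ^+ 2 - P n = (W * (F2 * (U * V))) n.
  have e2E : e%:R ^+ 2 = (e ^ 2)%:R :> fps R by rewrite natrX.
  by rewrite -key fpsB e2E fpsMnat natrX mulrC.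
rewrite -[leRHS]mulrA; apply: (bK _ (fun n => 6 * C * nu_max2 n)) => // i j ij.
by rewrite ler_wpM2l ?mulr_ge0 // nu_max2_homo.
Qed.

(** Here the constant must not depend on [e]. [G] is dominated by [2 geo 1 * B], where [B] counts
    partitions into parts at least 4; the factor [geo 1] produces the partial sums of
    [sum_sigma_term], and [B / (1 - X)^3] is [[2] [3] P]. *)
Lemma sigma_tail_term : exists2 C : R, 0 <= C & forall e n, (0 < e)%N ->
  `|(G * sigma_term R e) n| <= C / e%:R ^+ 2 * P n.
Proof.
have [C C0 bC] := bounded_opM (bounded_op_qint R 2) (bounded_op_qint R 3).
exists (4 * C) => [|e n e0]; first exact: mulr_ge0.
pose B := (1 - X ^+ 2) * (1 - X ^+ 3) * F.
have B0 : nonneg B by exact: nonneg_nu_without2.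
have GE : G = (geo 2 - X * 1 * geo 3) * B.
  rewrite geo_partial_fraction //; last by rewrite qintS mulr1.
  transitivity ((1 - X) * F * ((1 - X ^+ 2) * geo 2) * ((1 - X ^+ 3) * geo 3)).
    by rewrite !geoK ?mulr1.
  by rewrite /B; ring.
have dG : dominated G ((geo 1 + geo 1) * B).
  rewrite GE; apply: dominatedM; last exact: nonneg_dominated.
  by apply: dominatedB; [exact: dominated_geo | rewrite mulr1; exact: (dominated_Xn_geo R 1)].
apply: le_trans (dominatedM dG (nonneg_dominated (nonneg_sigma_term _ e0)) n) _.
have -> : (geo 1 + geo 1) * B * sigma_term R e = 2%:R * (geo 1 * sigma_term R e * B) by ring.
rewrite fpsMnat.
have : (geo 1 * sigma_term R e * B) n <= 2 / e%:R ^+ 2 * ((geo 1 * (geo 1 * geo 1)) * B) n.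
  rewrite [leLHS]fpsM [X in _ <= _ * X]fpsM mulr_sumr; apply: ler_sum => i _.
  rewrite [leRHS]mulrA ler_wpM2r //.
  exact: sum_sigma_term.
have -> : geo 1 * (geo 1 * geo 1) * B = qint 2 * qint 3 * P.
  transitivity (((1 - X) * geo 1) * ((1 - X) * geo 1) * (qint 2 * qint 3 * P)).
    by rewrite /B -!qintM; ring.
  by rewrite geo1K !mul1r.
have := bC P P ptn_homo ptn_norm n => /(le_trans (ler_norm _)) H1 H2.
apply: (@le_trans _ _ (2 * (2 / e%:R ^+ 2 * (C * P n)))).
  rewrite ler_wpM2l //; apply: le_trans H2 _; rewrite ler_wpM2l //.
by rewrite le_eqVlt; apply/orP; left; apply/eqP; ring.
Qed.

(** Both sides are the double sum of the [d X^(d e)], grouped by [d] or by [e]. *)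
Lemma sigma_sum_trunc N : eq_upto N (\sum_(1 <= d < N.+1) d%:R * (X ^+ d * geo d))
   (\sum_(1 <= e < N.+1) sigma_term R e).
Proof.
pose T d e : fps R := d%:R * X ^+ (d * e).
move=> n nN.
have L d : (0 < d)%N -> (d%:R * (X ^+ d * geo d)) n = \sum_(1 <= e < N.+1) T d e n.
  move=> d0; have E := geo_trunc R d0 nN; rewrite geoXn // in E.
  rewrite -(big_mkord xpredT (fun j => X ^+ (d * j))) big_ltn // muln0 expr0 !fpsD in E.
  move/addrI: E => E.
  rewrite fpsMnat -E fps_sum mulr_sumr; apply: eq_bigr => e _.
  by rewrite /T fpsMnat.
have M e : (0 < e)%N -> sigma_term R e n = \sum_(1 <= d < N.+1) T d e n.
  move=> e0; have e0' : e%:R != 0 :> R by rewrite pnatr_eq0 -lt0n.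
  apply: (mulfI e0'); rewrite sigma_termE // -(geo_trunc R e0 nN) fps_sum.
  rewrite -(big_mkord xpredT (fun j => (X ^+ (e * j)) n)) big_ltn // muln0 expr0 mulrDr.
  have -> : n%:R * (1 : fps R) n = 0 by case: (n) => [|k]; rewrite ?mul0r ?mulr0.
  rewrite add0r !mulr_sumr; apply: eq_bigr => d _.
  rewrite /T fpsMnat [(d * e)%N]mulnC mulrA -natrM fpsXn.
  by case: eqP => [->|]; rewrite ?mulr0.
rewrite !fps_sum big_nat; under eq_bigr => d /andP[d0 _] do rewrite L //.
rewrite -big_nat exchange_big big_nat [RHS]big_nat.
by apply: eq_bigr => e /andP[e0 _]; rewrite M.
Qed.

Lemma theta_parts2 N : fps_theta (parts2 R N) =
  parts2 R N * \sum_(2 <= d < N.+1) d%:R * (X ^+ d * geo d).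
Proof.
case: N => [|N]; first by rewrite /parts2 !big_geq // fps_theta1 mulr0.
elim: N => [|N IH]; first by rewrite parts2_1 big_geq // fps_theta1 mulr0.
rewrite parts2S // fps_thetaM IH fps_theta_geo // [in RHS]big_nat_recr //=; ring.
Qed.

(** Logarithmic differentiation of [(1 - X) F]. One [X F] comes from the derivative of [1 - X], the
    other from adding the missing term [d = 1], since [G * geo 1 = F]. *)
Lemma euler_identity n N : (0 < N)%N -> (n <= N)%N ->
  n%:R * G n = (\sum_(1 <= e < N.+1) (G * sigma_term R e) n) - 2 * (X * F) n.
Proof.
move=> N0 nN; have FE := nu_fps_trunc R N0.
have GE : eq_upto N G ((1 - X) * parts2 R N) by apply: eq_uptoM.
rewrite GE // -[LHS]/(fps_theta ((1 - X) * parts2 R N) n) fps_thetaM fps_thetaB fps_theta1.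
have := fps_thetaXn R 1; rewrite expr1 mul1r => ->.
rewrite sub0r theta_parts2 mulrA.
have -> : \sum_(2 <= d < N.+1) d%:R * (X ^+ d * geo d) =
    (\sum_(1 <= d < N.+1) d%:R * (X ^+ d * geo d)) - X * geo 1.
  by rewrite [in RHS]big_ltn // expr1 mul1r addrC addKr.
set S := \sum_(1 <= d < _) _.
have -> : - X * parts2 R N + (1 - X) * parts2 R N * (S - X * geo 1) =
  (1 - X) * parts2 R N * S - (X * parts2 R N * (1 + (1 - X) * geo 1)) by ring.
rewrite geo1K fpsB; congr (_ - _).
  transitivity ((\sum_(1 <= e < N.+1) G * sigma_term R e) n); last by rewrite fps_sum.
  rewrite -mulr_sumr; apply: (@eq_uptoM _ N) => //; last exact: sigma_sum_trunc.
  by move=> i iN; rewrite GE.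
rewrite -(fpsMnat 2) [RHS](_ : _ = (X * F * (1 + 1)) n); last by rewrite mulrC.
by symmetry; apply: (@eq_uptoM _ N) => //; apply: eq_uptoM.
Qed.

Definition zeta2_partial (J : nat) : R := \sum_(1 <= e < J.+1) (e%:R ^+ 2)^-1.

Lemma zeta2_tail J M : (0 < J)%N ->
  \sum_(J.+1 <= e < J + M.+1) (e%:R ^+ 2)^-1 <= J%:R^-1 :> R.
Proof.
(* The strengthened bound telescopes through [1 / (a + 1)^2 <= 1 / a - 1 / (a + 1)]. *)
move=> J0; suff : \sum_(J.+1 <= e < J + M.+1) (e%:R ^+ 2)^-1 <= J%:R^-1 - (J + M)%:R^-1 :> R.
  by move=> H; apply: le_trans H _; rewrite gerBl invr_ge0 ler0n.
elim: M => [|M]; first by rewrite addn1 big_geq // addn0 subrr.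
rewrite !addnS => IH; rewrite big_nat_recr /=; last by lia.
set a : R := (J + M)%:R in IH *.
have a0 : 0 < a by rewrite ltr0n; lia.
have -> : (J + M).+1%:R = a + 1 by rewrite -natr1.
suff : ((a + 1) ^+ 2)^-1 <= a^-1 - (a + 1)^-1 by move: IH; lra.
have -> : a^-1 - (a + 1)^-1 = (a * (a + 1))^-1 by field; lra.
by rewrite lef_pV2 ?posrE; nra.
Qed.

(** The Euler identity is cut at [e = J]: [sigma_main_term] treats the head, [sigma_tail_term] and
    [zeta2_tail] the rest. [C0] is fixed before [J], so that [C0 / J] can be made small. *)
Theorem gamma_second_order : exists2 C0 : R, 0 <= C0 & forall J, (0 < J)%N ->
  exists2 C : R, 0 <= C & forall n, (1 < n)%N ->
  `|n%:R * G n - zeta2_partial J * P n| <= C0 / J%:R * P n + C * F n.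
Proof.
have [C0 C00 tl] := sigma_tail_term; exists C0 => // J J0.
have [C C_ge0 mn] : exists2 C : R, 0 <= C & forall n,
    `|\sum_(1 <= e < J.+1) (G * sigma_term R e) n - zeta2_partial J * P n| <= C * nu_max2 n.
  rewrite /zeta2_partial; elim: J {J0} => [|J [C C_ge0 IH]].
    by exists 0 => // n; rewrite !big_geq // !mul0r subrr normr0.
  have [K K0 bK] := sigma_main_term (ltn0Sn J).
  exists (C + K) => [|n]; first exact: addr_ge0.
  move: (IH n) (bK n); rewrite !(@big_nat_recr _ _ _ J.+1) //=.
  set A := \sum_(1 <= e < J.+1) _; set z := \sum_(1 <= e < J.+1) _.
  set g := (_ * sigma_term R _) n; move=> IHn bKn.
  have -> : A + g - (z + (J.+1%:R ^+ 2)^-1) * P n =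
    (A - z * P n) + (g - P n / J.+1%:R ^+ 2) by ring.
  by rewrite (le_trans (ler_normD _ _)) // mulrDl lerD.
(* The 2 pays for the term [2 X F], and [1 < n] gives [nu_max2 n = F n]. *)
exists (C + 2) => [|n n1]; first exact: addr_ge0.
have Fn : nu_max2 n = F n by rewrite /nu_max2 (maxn_idPl n1).
have N0 : (0 < J + n)%N by rewrite addn_gt0 J0.
rewrite (euler_identity N0 (leq_addl _ _)).
rewrite (@big_cat_nat _ _ _ J.+1) //=; last by rewrite ltnS leq_addr.
set A := \sum_(1 <= e < J.+1) _; set B := \sum_(J.+1 <= e < _) _.
have -> : A + B - 2 * (X * F) n - zeta2_partial J * P n =
  B + ((A - zeta2_partial J * P n) - 2 * (X * F) n) by ring.
rewrite (le_trans (ler_normD _ _)) // lerD //.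
  rewrite /B (le_trans (ler_norm_sum _ _ _)) //.
  apply: (@le_trans _ _ (\sum_(J.+1 <= e < (J + n).+1) C0 * P n * (e%:R ^+ 2)^-1)).
    rewrite big_nat [leRHS]big_nat; apply: ler_sum => e /andP[eJ _].
    by rewrite [leRHS]mulrAC tl //; lia.
  rewrite -mulr_sumr [leRHS]mulrAC ler_wpM2l //.
    by rewrite mulr_ge0 // (le_trans _ (ptn_norm n)).
  by rewrite -addnS zeta2_tail.
rewrite (le_trans (ler_normB _ _)) // [leRHS]mulrDl -Fn lerD //; first exact: mn.
rewrite normrM normr_nat ler_wpM2l //.
rewrite fpsXM; case: n n1 Fn {mn N0 A B} => // n n1 Fn.
by rewrite (le_trans (nu_le_max2 _)) // nu_max2_homo.
Qed.

End SecondOrder.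

(** * The value of zeta(2) *)

Section Basel.
Variable R : realType.

Lemma sin_bounds (x : R) : 0 < x -> x < pi / 2 -> x * cos x <= sin x <= x.
Proof.
move=> x0 xpi.
have [|c] := @MVT R sin cos 0 x x0 (fun y _ => is_derive_sin y).
  by apply: continuous_subspaceT; exact: continuous_sin.
rewrite in_itv /= sin0 !subr0 => /andP[c0 cx] ->.
rewrite mulrC ler_pM2r // ger_pMl // cos_le1 andbT ltW //.
rewrite ltr_cos // in_itv /=; have := pi_gt0 R; lra.
Qed.

Definition csc2 (x : R) := (sin x ^+ 2)^-1.

(** Since [csc2 x - 1] is the squared cotangent, this restates [x cos x <= sin x <= x]. *)
Lemma csc2_bounds (x : R) : 0 < x -> x < pi / 2 -> csc2 x - 1 <= (x ^+ 2)^-1 <= csc2 x.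
Proof.
move=> x0 xpi; have /andP[lo hi] := sin_bounds x0 xpi.
have s0 : 0 < sin x by apply: sin_gt0_pihalf; rewrite x0.
have c0 : 0 < cos x by apply: cos_gt0_pihalf; rewrite xpi andbT; lra.
have s2 : 0 < sin x ^+ 2 by rewrite exprn_gt0.
have x2 : 0 < x ^+ 2 by rewrite exprn_gt0.
apply/andP; split; last by rewrite /csc2 lef_pV2 ?posrE // ler_sqr ?nnegrE ?(ltW s0) ?(ltW x0).
have -> : csc2 x - 1 = cos x ^+ 2 / sin x ^+ 2.
  by rewrite cos2sin2 /csc2; field; rewrite gt_eqF.
rewrite ler_pdivrMr // mulrC ler_pdivlMr // -exprMn mulrC.
by rewrite ler_sqr ?nnegrE ?(ltW s0) ?mulr_ge0 ?(ltW x0) ?(ltW c0).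
Qed.

Lemma csc2_double (x : R) : 0 < x -> x < pi / 2 ->
  csc2 x + csc2 (pi / 2 - x) = 4 * csc2 (x *+ 2).
Proof.
move=> x0 xpi.
have s0 : 0 < sin x by apply: sin_gt0_pihalf; rewrite x0.
have c0 : 0 < cos x by apply: cos_gt0_pihalf; rewrite xpi andbT; lra.
rewrite /csc2 sinB sin_pihalf cos_pihalf mul1r mul0r subr0 sin_mulr2n.
have := cos2Dsin2 x; set c := cos x in c0 *; set s := sin x in s0 *.
move=> cs; have -> : 4 * ((c * s *+ 2) ^+ 2)^-1 = (c ^+ 2 + s ^+ 2) / (c ^+ 2 * s ^+ 2).
  by rewrite cs; field; rewrite !gt_eqF.
by field; rewrite !gt_eqF.
Qed.

Definition odd_angle (n k : nat) : R := (k.*2.+1)%:R * pi / 2 ^+ n.+2.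

Lemma odd_angle_bounds n k : (k < 2 ^ n)%N -> 0 < odd_angle n k < pi / 2.
Proof.
move=> kn; have p0 := pi_gt0 R; rewrite /odd_angle; apply/andP; split.
  by rewrite divr_gt0 ?exprn_gt0 // mulr_gt0 // ltr0n.
rewrite ltr_pdivrMr ?exprn_gt0 // mulrC -mulrA ltr_pM2l // exprS mulKf ?pnatr_eq0 //.
rewrite -natrX ltr_nat expnS; lia.
Qed.

(* The angles [odd_angle n.+1 k] pair up as [x] and [pi / 2 - x], with the [2 x]
   running over the [odd_angle n k]. *)
Lemma sum_csc2_odd_angle n : \sum_(k < 2 ^ n) csc2 (odd_angle n k) = 2 * 4 ^+ n.
Proof.
elim: n => [|n IH].
  rewrite expn0 big_ord1 expr0 mulr1.
  have /andP[a0 a1] := @odd_angle_bounds 0 0 isT.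
  (* The only angle is [pi / 4], which is its own complement. *)
  have E : pi / 2 - odd_angle 0 0 = odd_angle 0 0.
    by rewrite /odd_angle /= mul1r; field.
  have := csc2_double a0 a1; rewrite E.
  have -> : odd_angle 0 0 *+ 2 = pi / 2 by rewrite /odd_angle /= mul1r -mulr_natl; field.
  by rewrite [csc2 (pi / 2)]/csc2 sin_pihalf expr1n invr1; lra.
have -> : (2 ^ n.+1 = 2 ^ n + 2 ^ n)%N by rewrite expnS mul2n addnn.
rewrite big_split_ord /= [X in _ + X](reindex_inj rev_ord_inj) /= -big_split /=.
rewrite exprS mulrCA -IH mulr_sumr; apply: eq_bigr => k _.
have kn : (k < 2 ^ n.+1)%N by rewrite (ltn_trans (ltn_ord k)) // ltn_exp2l.
have /andP[a0 a1] := odd_angle_bounds kn.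
have -> : odd_angle n k = odd_angle n.+1 k *+ 2.
  by rewrite /odd_angle -mulr_natl [2 ^+ n.+3]exprS; field; rewrite expf_neq0.
rewrite -csc2_double //; congr (_ + csc2 _).
rewrite /odd_angle; set m := (2 ^ n + (2 ^ n - k.+1))%N.
have -> : m.*2.+1%:R = 2 ^+ n.+2 - k.*2.+1%:R :> R.
  apply/eqP; rewrite -subr_eq opprK eq_sym -natrD -natrX; apply/eqP; congr (_%:R).
  have := ltn_ord k; rewrite /m !expnS; lia.
rewrite [2 ^+ n.+3]exprS; field; rewrite expf_neq0 //.
Qed.

Definition odd_zeta2 (M : nat) : R := \sum_(k < M) (k.*2.+1%:R ^+ 2)^-1.

(** Summing [csc2_bounds] over the odd angles puts the sum of their inverse squares between
    [2 * 4^n - 2^n] and [2 * 4^n]. Rescaling leaves an error [pi^2 / 16 / 2^n], and [pi < 4]. *)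
Lemma odd_zeta2_bounds n : `|pi ^+ 2 / 8 - odd_zeta2 (2 ^ n)| <= 2 ^- n.
Proof.
have p0 := pi_gt0 R.
have p4 : pi < 4 :> R by have := pihalf_lt2 R; lra.
have q0 : 0 < 2 ^+ n :> R by rewrite exprn_gt0.
have E : \sum_(k < 2 ^ n) (odd_angle n k ^+ 2)^-1 = 16 * (2 ^+ n) ^+ 2 / pi ^+ 2 * odd_zeta2 (2 ^ n).
  rewrite mulr_sumr; apply: eq_bigr => k _; rewrite /odd_angle !exprS.
  move: (pi : R) p0 {p4} (ltr0Sn R k.*2) => p p0 k0.
  by field; rewrite nat1r !gt_eqF.

have lo : 2 * 4 ^+ n - 2 ^+ n <= \sum_(k < 2 ^ n) (odd_angle n k ^+ 2)^-1.
  rewrite -sum_csc2_odd_angle -[X in _ - X]natrX -[X in X%:R]card_ord -sumr_const -sumrB.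
  apply: ler_sum => k _; have /andP[a0 a1] := odd_angle_bounds (ltn_ord k).
  by have /andP[] := csc2_bounds a0 a1.
have hi : \sum_(k < 2 ^ n) (odd_angle n k ^+ 2)^-1 <= 2 * 4 ^+ n.
  rewrite -sum_csc2_odd_angle; apply: ler_sum => k _.
  have /andP[a0 a1] := odd_angle_bounds (ltn_ord k).
  by have /andP[] := csc2_bounds a0 a1.
have q4 : 4 ^+ n = (2 ^+ n) ^+ 2 :> R by rewrite exprAC expr2 -natrM.
move: lo hi; rewrite {}E q4; set z := odd_zeta2 _; set q := 2 ^+ n in q0 *.
have c0 : 0 < 16 * q ^+ 2 / pi ^+ 2 by rewrite !mulr_gt0 ?invr_gt0 ?exprn_gt0.
set c := 16 * q ^+ 2 / pi ^+ 2 in c0 *.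
have E1 : 2 * q ^+ 2 = c * (pi ^+ 2 / 8).
  by rewrite /c; move: (pi : R) p0 => p p0; field; rewrite gt_eqF.
have E2 : q = c * (pi ^+ 2 / 16 / q).
  by rewrite /c; move: (pi : R) p0 => p p0; field; rewrite !gt_eqF.
rewrite {}E1 {1}E2 -mulrBr !ler_pM2l // => lo hi.
rewrite ger0_norm ?subr_ge0 //; apply: (@le_trans _ _ (pi ^+ 2 / 16 / q)); first lra.
rewrite ler_piMl ?invr_ge0 ?ltW //; nra.
Qed.

Lemma zeta2_partial_double M :
  zeta2_partial R (M + M) = odd_zeta2 M + zeta2_partial R M / 4.
Proof.
rewrite /zeta2_partial /odd_zeta2; elim: M => [|M IH].
  by rewrite !big_geq // big_ord0 mul0r addr0.
rewrite addnS addSn (@big_nat_recr _ _ _ (M + M).+2) // (@big_nat_recr _ _ _ (M + M).+1) //.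
rewrite (@big_nat_recr _ _ _ M.+1) //= IH big_ord_recr /= mulrDl.
have -> : ((M + M).+2%:R ^+ 2)^-1 = (M.+1%:R ^+ 2)^-1 / 4 :> R.
  have -> : (M + M).+2 = (2 * M.+1)%N by lia.
  by rewrite natrM; field; rewrite nat1r pnatr_eq0.
by rewrite -addnn; ring.
Qed.

(** Since [pi^2 / 6 = pi^2 / 8 + (pi^2 / 6) / 4], each doubling divides the error by 4 and adds at
    most [2^-n]. *)
Lemma zeta2_partial_pow2 n : `|pi ^+ 2 / 6 - zeta2_partial R (2 ^ n)| <= 4 / 2 ^+ n.
Proof.
have p0 := pi_gt0 R.
have p4 : pi < 4 :> R by have := pihalf_lt2 R; lra.
elim: n => [|n IH].
  rewrite expn0 expr0 /zeta2_partial big_nat1 expr1n invr1 mulr1 ler_norml; nra.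
have -> : (2 ^ n.+1 = 2 ^ n + 2 ^ n)%N by rewrite expnS mul2n addnn.
rewrite zeta2_partial_double; have O := odd_zeta2_bounds n.
have -> : pi ^+ 2 / 6 - (odd_zeta2 (2 ^ n) + zeta2_partial R (2 ^ n) / 4) =
  (pi ^+ 2 / 8 - odd_zeta2 (2 ^ n)) + (pi ^+ 2 / 6 - zeta2_partial R (2 ^ n)) / 4 by field.
rewrite (le_trans (ler_normD _ _)) // normrM [`|4^-1|]ger0_norm // [2 ^+ n.+1]exprS invfM.
move: IH O; lra.
Qed.

End Basel.

(** * A discrete Riccati equation *)

Section Riccati.
Variable R : realType.
Implicit Types (w g : nat -> R).

Lemma sqrt_natr_ge (K : R) : exists N, forall n, (N <= n)%N -> K <= Num.sqrt n%:R.
Proof.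
exists (Num.bound (K ^+ 2)) => n Kn; rewrite (le_trans (ler_norm _)) //.
rewrite -(@ler_pXn2r _ 2) ?nnegrE ?sqrtr_ge0 // real_normK ?num_real // sqr_sqrtr //.
by rewrite (le_trans (ltW (archi_boundP _))) ?sqr_ge0 // ler_nat.
Qed.

Lemma sqrt_natrS (n : nat) : (0 < n)%N ->
  [/\ 0 < Num.sqrt n%:R :> R, 0 < Num.sqrt n.+1%:R :> R &
  Num.sqrt n.+1%:R ^+ 2 = Num.sqrt n%:R ^+ 2 + 1 :> R].
Proof. by move=> n0; rewrite !sqrtr_gt0 !ltr0n !sqr_sqrtr // natr1. Qed.

(* [1 / m.+1] solves the recurrence exactly when [g = 0], so adding it to
   [a / sqrt n] absorbs an arbitrary initial value [w n0 <= 1]. *)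
Lemma riccati_upper w g (A a : R) N : (forall n, 0 <= w n <= 1) ->
  (forall n, w n.+1 * (1 + w n) = w n + g n.+1) ->
  (forall n, (N <= n)%N -> g n <= A / n%:R) -> 0 <= A -> 0 < a -> A < a ^+ 2 ->
  exists n0, forall m, w (n0 + m)%N <= a / Num.sqrt (n0 + m)%:R + m.+1%:R^-1.
Proof.
move=> w01 rec gA A0 a0 Aa.
(* Beyond this threshold [a (y - x) <= a^2 - A], because [y - x <= 1 / x] for the consecutive square
   roots [x] and [y]. *)
have [N1 N1P] := sqrt_natr_ge (a / (a ^+ 2 - A)).
exists (N + N1).+1; elim=> [|m IH].
  rewrite invr1 (le_trans (proj2 (andP (w01 _)))) // lerDr.
  by rewrite divr_ge0 ?sqrtr_ge0 // ltW.
rewrite addnS; set n := ((N + N1).+1 + m)%N in IH *.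
have n0 : (0 < n)%N by []. 
have [x0 y0 yx] := sqrt_natrS n0.
have xK : a / (a ^+ 2 - A) <= Num.sqrt n%:R by apply: N1P; rewrite /n; lia.
have : g n.+1 <= A / Num.sqrt n.+1%:R ^+ 2 by rewrite sqr_sqrtr // gA //; rewrite /n; lia.
have := rec n; have /andP[_ w1] := w01 n.+1; have /andP[wn0 _] := w01 n.
move: IH x0 y0 yx xK; set x := Num.sqrt n%:R; set y := Num.sqrt n.+1%:R.
set u := a / x + m.+1%:R^-1; set v := a / y + m.+2%:R^-1.
move=> wu x0 y0 yx xK rec' gA'.
have mS : 0 < m.+1%:R :> R by rewrite ltr0n.
have u0 : 0 < u by rewrite /u addr_gt0 ?divr_gt0 ?invr_gt0.
have sup : u + A / y ^+ 2 <= v * (1 + u).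
  have -> : v * (1 + u) = u + (a / y - a / x + a / y * (a / x)) +
      (a / y * m.+1%:R^-1 + a / x * m.+2%:R^-1).
    have -> : m.+2%:R = m.+1%:R + 1 :> R by rewrite -natr1.
    by rewrite /u /v -[m.+2%:R]natr1; field; rewrite !gt_eqF //; lra.
  rewrite -[leLHS]addr0 lerD //; last by rewrite addr_ge0 ?mulr_ge0 ?invr_ge0 ?ltW.
  rewrite lerD2l.
  have xy : x <= y by rewrite -(@ler_pXn2r _ 2) ?nnegrE ?(ltW x0) ?(ltW y0) // yx; lra.
  have d0 : 0 < a ^+ 2 - A by lra.
  rewrite ler_pdivrMr // in xK.
  have -> : a / y - a / x + a / y * (a / x) = (a ^+ 2 - a * (y - x)) / (x * y).
    by field; rewrite !gt_eqF.
  apply: (@le_trans _ _ (A / (x * y))).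
    by rewrite ler_wpM2l // lef_pV2 ?posrE ?mulr_gt0 ?exprn_gt0 // expr2 ler_wpM2r // ltW.
  rewrite ler_wpM2r ?invr_ge0 ?mulr_ge0 ?(ltW x0) ?(ltW y0) //.
  have yx1 : (y - x) * (y + x) = 1 by nra.
  have yx2 : (y - x) * x <= 1 by nra.
  have dlt : a * (y - x) <= a ^+ 2 - A.
    rewrite -(ler_pM2r x0); nra.
  lra.
(* The left side is [w n + g n.+1 + w n.+1 (u - w n)], where [w n <= u] and [w n.+1 <= 1]. *)
have le1 : w n.+1 * (1 + u) <= u + g n.+1 by nra.
have : w n.+1 * (1 + u) <= v * (1 + u) by lra.
by rewrite ler_pM2r //; lra.
Qed.

(* The subsolution vanishes at [n0]. *)
Lemma riccati_lower w g (A b : R) N : (forall n, 0 <= w n <= 1) ->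
  (forall n, w n.+1 * (1 + w n) = w n + g n.+1) ->
  (forall n, (N <= n)%N -> A / n%:R <= g n) -> 0 < b -> b ^+ 2 < A ->
  exists n0, forall n, (n0 <= n)%N -> b / Num.sqrt n%:R - b * Num.sqrt n0%:R / n%:R <= w n.
Proof.
move=> w01 rec gA b0 bA.
have [N1 N1P] := sqrt_natr_ge (b / (A - b ^+ 2)).
exists (N + N1).+1 => n /subnK <-; elim: (n - _)%N => [|m IH].
  rewrite add0n; set x := Num.sqrt _.
  have x0 : 0 < x by rewrite sqrtr_gt0 ltr0n.
  rewrite -[X in _ - _ / X <= _](@sqr_sqrtr R) // -/x.
  have -> : b / x - b * x / x ^+ 2 = 0 by field; rewrite gt_eqF.
  by have /andP[] := w01 (N + N1).+1.
rewrite addSn; set n1 := (m + (N + N1).+1)%N in IH *.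
have n0 : (0 < n1)%N by rewrite /n1; lia.
have [x0 y0 yx] := sqrt_natrS n0.
have xK : b / (A - b ^+ 2) <= Num.sqrt n1%:R by apply: N1P; rewrite /n1; lia.
have tx : Num.sqrt (N + N1).+1%:R <= Num.sqrt n1%:R :> R.
  by rewrite ler_sqrt // ler_nat /n1; lia.
have t1 : 1 <= Num.sqrt (N + N1).+1%:R :> R.
  by rewrite -[X in X <= _]sqrtr1 ler_sqrt // ler1n.
have : A / Num.sqrt n1.+1%:R ^+ 2 <= g n1.+1 by rewrite sqr_sqrtr // gA //; rewrite /n1; lia.
have := rec n1; have /andP[_ w1] := w01 n1.+1; have /andP[wn0 _] := w01 n1.
rewrite -[X in _ - _ / X <= _](@sqr_sqrtr R) // in IH.
rewrite -[X in _ - _ / X <= _](@sqr_sqrtr R) //.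
move: IH x0 y0 yx xK tx t1; set x := Num.sqrt n1%:R; set y := Num.sqrt n1.+1%:R.
set t := Num.sqrt (N + N1).+1%:R.
set u := b / x - b * t / x ^+ 2; set v := b / y - b * t / y ^+ 2.
move=> uw x0 y0 yx xK tx t1 rec' gA'.
have u0 : 0 <= u.
  have -> : u = b * (x - t) / x ^+ 2 by rewrite /u; field; rewrite gt_eqF.
  by rewrite divr_ge0 ?exprn_ge0 ?mulr_ge0 ?subr_ge0 // ltW.
have xy : x <= y by rewrite -(@ler_pXn2r _ 2) ?nnegrE ?(ltW x0) ?(ltW y0) // yx; lra.
have yx1 : y <= x + 1 by rewrite -(@ler_pXn2r _ 2) ?nnegrE ?(ltW x0) ?(ltW y0) // ?yx; nra.
(* As [y^2 = x^2 + 1] and [y - t <= x] (from [1 <= t]), the numerator of the difference is at least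
   [(A - b^2) x^2 - b t], which the threshold on [x] makes nonnegative. *)
have sub : v * (1 + u) <= u + A / y ^+ 2.
  have d0 : 0 < A - b ^+ 2 by lra.
  rewrite ler_pdivrMr // in xK.
  have xy0 : 0 < x ^+ 2 * y ^+ 2 by rewrite mulr_gt0 ?exprn_gt0.
  rewrite -subr_ge0.
  have -> : u + A / y ^+ 2 - v * (1 + u) =
   (b * x * y * (y - x) - b * t * (y ^+ 2 - x ^+ 2) + A * x ^+ 2 - b ^+ 2 * (x - t) * (y - t))
      / (x ^+ 2 * y ^+ 2).
    by rewrite /u /v; field; rewrite !gt_eqF.
  rewrite divr_ge0 ?(ltW xy0) // yx.
  have : 0 <= b * x * y * (y - x) by rewrite !mulr_ge0 ?subr_ge0 ?(ltW b0) ?(ltW x0) ?(ltW y0).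
  have : b * t <= (A - b ^+ 2) * x ^+ 2.
    rewrite expr2 mulrA; apply: ler_pM; rewrite ?(ltW b0) //; [lra | lra].
  have : b ^+ 2 * (x - t) * (y - t) <= b ^+ 2 * x ^+ 2.
    rewrite -mulrA ler_wpM2l ?sqr_ge0 // expr2; apply: ler_pM; lra.
  by move=> h1 h2 h3; lra.
have le1 : u + g n1.+1 <= w n1.+1 * (1 + u) by nra.
have : v * (1 + u) <= w n1.+1 * (1 + u) by lra.
by rewrite ler_pM2r //; lra.
Qed.

End Riccati.

Local Open Scope classical_set_scope.
Local Open Scope ring_scope.

(** * Limits of solutions of the Riccati recurrence *)

Section RiccatiAsymptotics.
Variable R : realType.
Implicit Types (w g : nat -> R).

(** Once [n >= 2 n0], the second term of the supersolution times [sqrt n] is at most [2 / sqrt n],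
    hence eventually below [d]. *)
Lemma riccati_limsup w g (A a d : R) N : (forall n, 0 <= w n <= 1) ->
  (forall n, w n.+1 * (1 + w n) = w n + g n.+1) ->
  (forall n, (N <= n)%N -> g n <= A / n%:R) -> 0 <= A -> 0 < a -> A < a ^+ 2 ->
  0 < d -> exists M, forall n, (M <= n)%N -> Num.sqrt n%:R * w n <= a + d.
Proof.
move=> w01 rec gA A0 a0 Aa d0.
have [n0 up] := riccati_upper w01 rec gA A0 a0 Aa.
have [M MP] := sqrt_natr_ge (2 / d).
exists (M + n0.*2).+1 => n nM.
have := up (n - n0)%N; rewrite subnKC; last by lia.
have {}MP := MP n ltac:(lia).
have x0 : 0 < Num.sqrt n%:R :> R by rewrite sqrtr_gt0 ltr0n; lia.
have x2 : Num.sqrt n%:R ^+ 2 = n%:R :> R by rewrite sqr_sqrtr.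
have : (n%:R <= 2 * (n - n0).+1%:R :> R) by rewrite -natrM ler_nat; lia.
move: MP x0 x2; set x := Num.sqrt _; set k := (n - n0).+1%:R => MP x0 <- xk wle.
have k0 : 0 < k by rewrite ltr0n.
rewrite ler_pdivrMr // in MP.
have -> : a + d = x * ((a + d) / x) by field; rewrite gt_eqF.
rewrite ler_pM2l //; apply: le_trans wle _; rewrite mulrDl lerD2l.
by rewrite -[k^-1]mul1r ler_pdivrMr // mulrAC ler_pdivlMr //; nra.
Qed.

Lemma riccati_liminf w g (A b d : R) N : (forall n, 0 <= w n <= 1) ->
  (forall n, w n.+1 * (1 + w n) = w n + g n.+1) ->
  (forall n, (N <= n)%N -> A / n%:R <= g n) -> 0 < b -> b ^+ 2 < A ->
  0 < d -> exists M, forall n, (M <= n)%N -> b - d <= Num.sqrt n%:R * w n.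
Proof.
move=> w01 rec gA b0 bA d0.
have [n0 lo] := riccati_lower w01 rec gA b0 bA.
have [M MP] := sqrt_natr_ge (b * Num.sqrt n0%:R / d).
exists (M + n0).+1 => n nM.
have := lo n ltac:(lia); have {}MP := MP n ltac:(lia).
have x0 : 0 < Num.sqrt n%:R :> R by rewrite sqrtr_gt0 ltr0n; lia.
rewrite -[X in _ - _ / X <= _](@sqr_sqrtr R) //.
move: MP x0; set x := Num.sqrt n%:R; set t := Num.sqrt n0%:R => MP x0 wge.
rewrite ler_pdivrMr // in MP.
apply: le_trans (_ : x * (b / x - b * t / x ^+ 2) <= _); last by rewrite ler_pM2l.
have -> : x * (b / x - b * t / x ^+ 2) = b - b * t / x by field; rewrite gt_eqF.
by rewrite lerD2l lerN2 ler_pdivrMr // [leRHS]mulrC.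
Qed.

Lemma riccati_cvg w g (z : R) : (forall n, 0 <= w n <= 1) ->
  (forall n, w n.+1 * (1 + w n) = w n + g n.+1) -> 0 < z ->
  (fun n => n%:R * g n) @ \oo --> z ->
  (fun n => Num.sqrt n%:R * w n) @ \oo --> Num.sqrt z.
Proof.
move=> w01 rec z0 gz; set c := Num.sqrt z.
have c0 : 0 < c by rewrite sqrtr_gt0.
have cz : c ^+ 2 = z by rewrite sqr_sqrtr // ltW.
apply/cvgrPdist_le => e e0.
have gN (d : R) : 0 < d -> exists N, forall n, (N <= n)%N ->
    (z - d) / n%:R <= g n /\ g n <= (z + d) / n%:R.
  move=> d0; have /cvgrPdist_le/(_ _ d0)[N _ NP] := gz.
  exists N.+1 => n Nn; have n0 : 0 < n%:R :> R by rewrite ltr0n; lia.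
  have := NP n (ltnW Nn); rewrite ler_distl => /andP[h1 h2].
  by rewrite ler_pdivrMr // ler_pdivlMr // [g n * _]mulrC; split; lra.
have [M1 M1P] : exists M, forall n, (M <= n)%N -> Num.sqrt n%:R * w n <= c + e.
  (* As [c^2 = z], the choice [A = z + c e / 2], [a = c + e / 2] satisfies [A < a^2]. *)
  have d0 : 0 < c * e / 2 by rewrite !mulr_gt0 ?invr_gt0.
  have [N NP] := gN _ d0.
  have [|||||M MP] := @riccati_limsup w g (z + c * e / 2) (c + e / 2) (e / 2) N w01 rec;
    [by move=> n /NP[] | by lra | by lra | by nra | by lra | ].
  by exists M => n /MP; lra.
have [M2 M2P] : exists M, forall n, (M <= n)%N -> c - e <= Num.sqrt n%:R * w n.
  (* For [c <= e] the bound is trivial because [w n >= 0]; for [e < c] one has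
     [(c - e / 2)^2 < z - c e / 2]. *)
  have [ce|ce] := leP c e.
    exists 0%N => n _; apply: (@le_trans _ _ 0); first by lra.
    by rewrite mulr_ge0 ?sqrtr_ge0 //; have /andP[] := w01 n.
  have d0 : 0 < c * e / 2 by rewrite !mulr_gt0 ?invr_gt0.
  have [N NP] := gN _ d0.
  have [||||M MP] := @riccati_liminf w g (z - c * e / 2) (c - e / 2) (e / 2) N w01 rec;
    [by move=> n /NP[] | by lra | by nra | by lra | ].
  by exists M => n /MP; lra.
exists (M1 + M2)%N => // n /= nM; rewrite ler_distlC.
by rewrite M1P ?M2P //; lia.
Qed.

End RiccatiAsymptotics.

(** * Asymptotics of the ratios of [nu] and [gamma] to the partition function *)

Section Asymptotics.
Variable R : realType.
Local Notation X := (@fpsX R).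
Local Notation F := (nu_fps R).
Local Notation G := ((1 - X) * F).
Local Notation P := (geo 1 * F).

Lemma gamma_second_order_pi (eps : R) : 0 < eps -> exists2 C : R, 0 <= C &
  forall n, (1 < n)%N -> `|n%:R * G n - pi ^+ 2 / 6 * P n| <= eps * P n + C * F n.
Proof.
move=> e0; have [C0 C00 so] := gamma_second_order R.
(* With [J = 2^k], the numerator adds the error [C0 / J] of the second-order relation and the error
   [4 / J] of the partial zeta sum. *)
pose k := Num.bound ((C0 + 4) / eps).
have kP : (C0 + 4) / 2 ^+ k <= eps.
  rewrite ler_pdivrMr ?exprn_gt0 // mulrC -ler_pdivrMr //.
  rewrite (le_trans (ltW (archi_boundP _))) ?divr_ge0 ?addr_ge0 ?(ltW e0) //.
  by rewrite -natrX ler_nat ltnW // ltn_expl.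
have [|C C_ge0 soC] := so (2 ^ k)%N; first by rewrite expn_gt0.
exists C => // n n1; have Z := zeta2_partial_pow2 R k.
have P0 : 0 <= P n by rewrite (le_trans _ (ptn_norm R n)).
have := soC n n1; rewrite natrX; set zJ := zeta2_partial _ _ in Z *.
move=> H; have -> : n%:R * G n - pi ^+ 2 / 6 * P n =
  (n%:R * G n - zJ * P n) - (pi ^+ 2 / 6 - zJ) * P n by ring.
apply: le_trans (ler_normB _ _) _; rewrite normrM [`|P n|]ger0_norm //.
have := ler_wpM2r P0 Z; have := ler_wpM2r P0 kP; rewrite mulrDl mulrDl.
move: H; set t := C0 / 2 ^+ k * P n; set u := 4 / 2 ^+ k * P n; lra.
Qed.

Lemma ptn_gt0 n : 0 < P n.
Proof.
rewrite geo1M big_ord_recl nu_fps0 ltr_wpDr //.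
by rewrite sumr_ge0 // => i _; exact: ler0n.
Qed.

Definition nu_ratio n : R := F n / P n.
Definition gamma_ratio n : R := G n / P n.

Lemma nu_ratio01 n : 0 <= nu_ratio n <= 1.
Proof.
rewrite divr_ge0 ?ler0n ?(ltW (ptn_gt0 n)) // ler_pdivrMr ?ptn_gt0 // mul1r.
by rewrite geo1M big_ord_recr lerDr sumr_ge0 // => i _; exact: ler0n.
Qed.

Lemma nu_ratio_rec n : nu_ratio n.+1 * (1 + nu_ratio n) = nu_ratio n + gamma_ratio n.+1.
Proof.
rewrite /nu_ratio /gamma_ratio.
have PS : P n.+1 = P n + F n.+1 by rewrite !geo1M big_ord_recr.
have -> : G n.+1 = F n.+1 - F n by rewrite mulrBl mul1r fpsB fpsXM.
have := ptn_gt0 n.+1; have := ptn_gt0 n; rewrite PS; move: (P n) (F n) (F n.+1) => p f f' p0 p0'.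
by field; rewrite !gt_eqF.
Qed.

Lemma gamma_ratio_bound (eps : R) : 0 < eps -> exists2 C : R, 0 <= C &
  forall n, (1 < n)%N -> `|pi ^+ 2 / 6 - n%:R * gamma_ratio n| <= eps + C * nu_ratio n.
Proof.
move=> e0; have [C C0 H] := gamma_second_order_pi e0; exists C => // n n1.
have := H n n1; have := ptn_gt0 n; rewrite /nu_ratio /gamma_ratio.
move: (pi ^+ 2 / 6 : R) (P n) (F n) (G n) => z p f g p0 Hn.
have -> : z - n%:R * (g / p) = - (n%:R * g - z * p) / p by field; rewrite gt_eqF.
have -> : eps + C * (f / p) = (eps * p + C * f) / p by field; rewrite gt_eqF.
by rewrite normrM normrN normfV (gtr0_norm p0) ler_pM2r // invr_gt0.
Qed.

(** A bootstrap: the crude bound [nu_ratio n <= 1] already gives [gamma_ratio n <= A / n], and the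
    Riccati upper bound then makes [nu_ratio n] of order at most [1 / sqrt n]. *)
Lemma nu_ratio_cvg0 : nu_ratio @ \oo --> (0 : R).
Proof.
have [C C0 H] := gamma_ratio_bound ltr01.
have z0 : 0 <= pi ^+ 2 / 6 :> R by rewrite divr_ge0 // sqr_ge0.
pose A : R := pi ^+ 2 / 6 + 1 + C; have A0 : 0 <= A by rewrite /A; lra.
have [|||||M MP] := @riccati_limsup R nu_ratio gamma_ratio A (A + 1) 1 2 nu_ratio01 nu_ratio_rec.
- move=> n n1; have n0 : 0 < n%:R :> R by rewrite ltr0n; lia.
  rewrite ler_pdivlMr // mulrC.
  have := H n n1; rewrite ler_distlC => /andP[_].
  have /andP[_ w1] := nu_ratio01 n; have := ler_wpM2l C0 w1; rewrite /A; lra.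
- by [].
- by lra.
- by nra.
- by [].
apply/cvgrPdist_le => e e0; have [M2 M2P] := sqrt_natr_ge ((A + 2) / e).
exists (M + M2).+1 => // n /= nM; rewrite sub0r normrN.
have /andP[w0 _] := nu_ratio01 n; rewrite ger0_norm //.
have x0 : 0 < Num.sqrt n%:R :> R by rewrite sqrtr_gt0 ltr0n; lia.
rewrite -(ler_pM2l x0) (le_trans (MP n _)) //; first by lia.
have := M2P n ltac:(lia); rewrite ler_pdivrMr //; lra.
Qed.

Lemma gamma_ratio_cvg : (fun n => n%:R * gamma_ratio n) @ \oo --> (pi ^+ 2 / 6 : R).
Proof.
apply/cvgrPdist_le => e e0.
have [C C0 H] := gamma_ratio_bound (divr_gt0 e0 (ltr0Sn R 1)).
have d0 : 0 < e / 2 / (C + 1) by rewrite !divr_gt0 //; lra.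
have /cvgrPdist_le/(_ _ d0)[N _ NP] := nu_ratio_cvg0.
exists (N + 2)%N => // n /= nN; apply: le_trans (H n _) _; first by lia.
have := NP n (leq_trans (leq_addr 2 N) nN); rewrite sub0r normrN; have /andP[w0 _] := nu_ratio01 n.
rewrite ger0_norm // ler_pdivlMr; last by lra.
by move=> h; nra.
Qed.

Lemma nu_gamma_ratio_cvg :
  (fun n => F n / (G n * Num.sqrt (n%:R / (pi ^+ 2 / 6)))) @ \oo --> (1 : R).
Proof.
set z : R := pi ^+ 2 / 6.
have z0 : 0 < z by rewrite divr_gt0 // exprn_gt0 // pi_gt0.
have gz := gamma_ratio_cvg; rewrite -/z in gz.
have wz := riccati_cvg nu_ratio01 nu_ratio_rec z0 gz.
have sz : Num.sqrt z != 0 by rewrite gt_eqF // sqrtr_gt0.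
have lE : Num.sqrt z * Num.sqrt z / z = 1.
  by rewrite -expr2 sqr_sqrtr ?ltW // divff // gt_eqF.
have lim : (fun n => Num.sqrt n%:R * nu_ratio n * Num.sqrt z / (n%:R * gamma_ratio n)) @ \oo
    --> Num.sqrt z * Num.sqrt z / z.
  apply: cvgM; last by apply: cvgV => //; rewrite gt_eqF.
  by apply: cvgM => //; exact: cvg_cst.
rewrite lE in lim; apply: cvg_trans lim; apply: near_eq_cvg; exists 1%N => // n /= n1.
have x0 : 0 < Num.sqrt n%:R :> R by rewrite sqrtr_gt0 ltr0n.
rewrite [Num.sqrt (n%:R / z)]sqrtrM ?ler0n // [Num.sqrt z^-1]sqrtrV ?(ltW z0) // /nu_ratio /gamma_ratio.
(* If [G n = 0], both quotients are 0, since the inverse of 0 is 0. *)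
have [->|G0] := eqVneq (G n) 0; first by rewrite !mul0r mulr0 invr0 !mulr0.
have p0 := ptn_gt0 n.
rewrite -[X in X * (G n / P n)](@sqr_sqrtr R) ?ler0n //.
move: (Num.sqrt n%:R) (Num.sqrt z) (P n) (F n) (G n) x0 sz p0 G0 => x y p f g x0 y0 p0 g0.
by field; rewrite y0 g0 !gt_eqF.
Qed.

End Asymptotics.

(* nu(n) ~ gamma(n) * sqrt(n / zeta(2)), zeta(2) = pi^2/6 *)
Theorem theorem2 (R : realType) :
  (fun n : nat => ((nu n)%:R : R) /
      ((gamma n)%:R * Num.sqrt (n%:R / (pi ^+ 2 / 6)))) @ \oo --> (1 : R).
Proof.
have lim := @nu_gamma_ratio_cvg R.
apply: cvg_trans lim; apply: near_eq_cvg; exists 3%N => // n /= n3.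
rewrite gamma_nu //; congr (_ / (_ * _)).
by case: n n3 => // n _; rewrite mulrBl mul1r fpsB fpsXM.
Qed.
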